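(* Let $(X,\mathcal{U})$ be a quasi-uniform space and let $T\colon X\to X$ be order-preserving. If $x_0$ is a $\mathcal{U}$-fixed point of $T$, then $\pi(x_0)$ is a $\widetilde{\mathcal{U}}$-fixed point of $\widetilde T$. If $T$ is also an involution, i.e. $T\circ T=\mathrm{id}_X$, then $\widetilde T$ is an involution and $\widetilde T(\pi(x_0))=\pi(x_0)$ in $\widetilde X$, equivalently $T(x_0)\equiv_{\mathcal{U}}x_0$.
   Context: $X$ is a non-empty set. A quasi-uniformity on $X$ is a filter $\mathcal{U}$ on $X\times X$ such that every $U\in\mathcal{U}$ contains the diagonal $\Delta_X$ and for every $U\in\mathcal{U}$ there is $V\in\mathcal{U}$ with $V\circ V\subseteq U$, where $V\circ V=\{(x,z):\exists y,\ (x,y)\in V,\ (y,z)\in V\}$. The relation $\bigcap\mathcal{U}:=\bigcap_{U\in\mathcal{U}}U$ is a preorder on $X$. A point $x_0$ is a $\mathcal{U}$-fixed point of $T\colon X\to X$ if $(x_0,Tx_0)\in\bigcap\mathcal{U}$ (and similarly for any other quasi-uniform space). Write $x\equiv_{\mathcal{U}}y$ if $(x,y)\in\bigcap\mathcal{U}$ and $(y,x)\in\bigcap\mathcal{U}$; this is an equivalence relation. Let $\widetilde X:=X/{\equiv_{\mathcal{U}}}$ with quotient map $\pi\colon X\to\widetilde X$. The $T_0$-quotient of $(X,\mathcal{U})$ is $(\widetilde X,\widetilde{\mathcal{U}})$, where $\widetilde{\mathcal{U}}$ is the filter on $\widetilde X\times\widetilde X$ generated by the base $\{(\pi\times\pi)(U):U\in\mathcal{U}\}$;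 it is a quasi-uniformity with $\bigcap\widetilde{\mathcal{U}}$ antisymmetric. A map $T\colon X\to X$ is order-preserving if $(x,y)\in\bigcap\mathcal{U}$ implies $(Tx,Ty)\in\bigcap\mathcal{U}$. An order-preserving $T$ respects $\equiv_{\mathcal{U}}$ and so induces the well-defined map $\widetilde T\colon\widetilde X\to\widetilde X$, $\widetilde T(\pi(x))=\pi(Tx)$. *)

(* Defs.v *)
From HB Require Import structures.
From mathcomp Require Import all_boot.
From mathcomp Require Import all_classical.

Set Implicit Arguments.
Unset Strict Implicit.
Unset Printing Implicit Defensive.

Local Open Scope classical_set_scope.
Local Open Scope relation_scope.
Local Open Scope quotient_scope.

(* For nonempty X, qu_diagonal makes the filter proper. *)
Record quasi_uniformity (X : Type) := QuasiUniformity {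
  qu_entourage :> set_system (X * X);
  qu_filter : Filter qu_entourage;
  qu_diagonal : forall A, qu_entourage A -> diagonal `<=` A;
  qu_split : forall A, qu_entourage A -> exists2 B, qu_entourage B & B \; B `<=` A }.

#[global] Existing Instance qu_filter.

Section Specialization.
Context {X : Type} (U : quasi_uniformity X).

Definition qu_core : set (X * X) := \bigcap_(A in (U : set_system (X * X))) A.

Definition qu_fixed_point (T : X -> X) (x0 : X) : Prop := qu_core (x0, T x0).

Definition order_preserving (T : X -> X) : Prop :=
  forall x y, qu_core (x, y) -> qu_core (T x, T y).

Definition qu_equiv (x y : X) : Prop := qu_core (x, y) /\ qu_core (y, x).

Lemma qu_core_refl x : qu_core (x, x).
Proof. by move=> A UA; apply: (qu_diagonal UA). Qed.

Lemma qu_core_trans y x z : qu_core (x, y) -> qu_core (y, z) -> qu_core (x, z).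
Proof.
move=> xy yz A /qu_split[B UB]; apply.
by exists y => /=; [exact: xy|exact: yz].
Qed.

End Specialization.

Section T0Quotient.
Context {X : choiceType} (U : quasi_uniformity X).

Definition qu_equivb : rel X := fun x y => `[< qu_equiv U x y >].

Let qu_equivb_refl : reflexive qu_equivb.
Proof. by move=> x; apply/asboolP; split; exact: qu_core_refl. Qed.

Let qu_equivb_sym : symmetric qu_equivb.
Proof. by move=> x y; apply/asboolP/asboolP => -[]. Qed.

Let qu_equivb_trans : transitive qu_equivb.
Proof.
move=> y x z /asboolP[xy yx] /asboolP[yz zy]; apply/asboolP.
by split; apply: (@qu_core_trans _ _ y).
Qed.

Canonical qu_equiv_rel :=
  EquivRel qu_equivb qu_equivb_refl qu_equivb_sym qu_equivb_trans.

Definition T0_quotient : Type := {eq_quot qu_equivb}.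
HB.instance Definition _ := Choice.on T0_quotient.
HB.instance Definition _ := EqQuotient.on T0_quotient.

Definition T0_pi (x : X) : T0_quotient := \pi_T0_quotient x.

Lemma T0_piP x y : T0_pi x = T0_pi y <-> qu_equiv U x y.
Proof.
split=> [/eqquotP/asboolP//|xy]; by apply/eqquotP/asboolP.
Qed.

Definition T0_entourage : set_system (T0_quotient * T0_quotient) :=
  filter_from (U : set_system (X * X))
    (fun A => [set (T0_pi xy.1, T0_pi xy.2) | xy in A]).

Let T0_filter : Filter T0_entourage.
Proof.
apply: filter_from_filter; first by exists setT; exact: filterT.
move=> A B UA UB; exists (A `&` B); first exact: filterI.
by move=> _ [xy [Axy Bxy] <-]; split; exists xy.
Qed.

Let T0_diagonal A : T0_entourage A -> diagonal `<=` A.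
Proof.
move=> [B UB BA] [a b] /diagonalP ->; apply: BA; exists (repr b, repr b) => /=.
  exact: qu_core_refl UB.
by rewrite /T0_pi reprK.
Qed.

Let T0_split A :
  T0_entourage A -> exists2 B, T0_entourage B & B \; B `<=` A.
Proof.
move=> [B /qu_split[C /[dup] UC /qu_split[D UD DC] CB] BA].
exists [set (T0_pi xy.1, T0_pi xy.2) | xy in C `&` D].
  by exists (C `&` D) => //; exact: filterI.
move=> [a c] /= [b [[x y] /= [Cxy Dxy] [<- yb]] [[y' z] /= [Cyz Dyz] [yb' <-]]].
apply: BA; exists (x, z) => //; apply: CB; exists y => //=.
apply: DC; exists y' => //=.
have /T0_piP[+ _] : T0_pi y = T0_pi y' by rewrite yb yb'.
exact.
Qed.

Definition T0_uniformity : quasi_uniformity T0_quotient :=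
  QuasiUniformity T0_filter T0_diagonal T0_split.

(* The induced map, computed on representatives; T0_mapE shows that this does
   not depend on the representative when T is order-preserving. *)
Definition T0_map (T : X -> X) (a : T0_quotient) : T0_quotient :=
  T0_pi (T (repr a)).

Lemma T0_mapE (T : X -> X) : order_preserving U T ->
  forall x, T0_map T (T0_pi x) = T0_pi (T x).
Proof.
move=> Tmono x; apply/T0_piP.
have /T0_piP[rx xr] : T0_pi (repr (T0_pi x)) = T0_pi x by exact: reprK.
by split; exact: Tmono.
Qed.

End T0Quotient.

Arguments T0_pi {X} U x.
Arguments T0_map {X} U T a.

(* Main.v *)
Require Import Defs.
From HB Require Import structures.
From mathcomp Require Import all_boot.
From mathcomp Require Import all_classical.

Local Open Scope classical_set_scope.

(** By [T0_mapE] the induced map sends the class of [x] to the class of [T x], so every claim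
    reduces to representatives. An involution turns the fixed-point inequality around: applying [T]
    to [x0] below [T x0] puts [T x0] below [x0], and [T0_piP] makes the two classes equal. *)

Theorem lemma8p1 (X : choiceType) (X_nonempty : [set: X] !=set0)
    (U : quasi_uniformity X) (T : X -> X)
    (T_order_preserving : order_preserving U T) :
  (forall x0 : X, qu_fixed_point U T x0 ->
     qu_fixed_point (T0_uniformity U) (T0_map U T) (T0_pi U x0)) /\
  (T \o T = id ->
     T0_map U T \o T0_map U T = id /\
     forall x0 : X, qu_fixed_point U T x0 ->
       T0_map U T (T0_pi U x0) = T0_pi U x0 /\
       (T0_map U T (T0_pi U x0) = T0_pi U x0 <-> qu_equiv U (T x0) x0)).
Proof.
have TE := T0_mapE T_order_preserving.
split=> [x0 fx0|TT].
  (* An entourage of the quotient contains the image of some [B] in [U], and [B] contains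
     [(x0, T x0)]. *)
  by rewrite /qu_fixed_point TE => A [B UB]; apply; exists (x0, T x0) => //; exact: fx0.
have TTx x : T (T x) = x by have := congr1 (@^~ x) TT.
split.
  apply/funext => a; rewrite -[a]reprK /=.
  (* Folding the generic projection into [T0_pi] lets [TE] rewrite. *)
  by rewrite -[\pi_(T0_quotient U)%qT (repr a)]/(T0_pi U (repr a)) !TE TTx.
move=> x0 fx0; rewrite TE; split; last exact: T0_piP.
apply/T0_piP; split=> //.
(* Monotonicity gives [(T x0, T (T x0))] in the core, which is [(T x0, x0)]. *)
by have := T_order_preserving _ _ fx0; rewrite TTx.
Qed.
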